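(* Let $T:V\to\mathcal A$ be an anti-super-$\mathcal O$-operator on a super-commutative Hom-associative superalgebra $(\mathcal A,\mu,\alpha)$ with respect to a representation $(V,\eta,\beta)$. Define a binary operation $\star_T:V\times V\to V$ by $$u\star_T v=-\eta(T(u))v$$ for homogeneous $u,v\in V$. Then $(V,\star_T,\beta)$ is a Hom-anti-Zinbiel superalgebra if and only if $T$ is strong. In this case $T$ is a homomorphism of super-commutative Hom-associative superalgebras from $(V,\mu_{\star_T},\beta)$ to $(\mathcal A,\mu,\alpha)$, where $\mu_{\star_T}(u,v)=u\star_T v+(-1)^{|u||v|}v\star_T u$. Furthermore, there is an induced Hom-anti-Zinbiel superalgebra structure on $T(V)=\{T(u): u\in V\}\subseteq\mathcal A$ (with twisting map the restriction of $\alpha$) given by $T(u)\star T(v)=T(u\star_T v)$ for all homogeneous $u,v\in V$.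
   Context: All vector spaces are finite-dimensional over a field of characteristic $0$. Superspaces are $\mathbb Z_2$-graded, $|x|$ is the parity of a homogeneous element $x$, and identities are required for homogeneous elements. All structure maps are even (parity preserving). A super-commutative Hom-associative superalgebra is a triple $(\mathcal A,\mu,\alpha)$ with $\mu$ even bilinear and $\alpha$ even linear such that $\mu(x,y)=(-1)^{|x||y|}\mu(y,x)$ and $\mu(\mu(x,y),\alpha(z))=\mu(\alpha(x),\mu(y,z))$. A homomorphism between two such is an even linear map intertwining the products and the twisting maps. A representation of $(\mathcal A,\mu,\alpha)$ is a triple $(V,\eta,\beta)$ with $V$ a $\mathbb Z_2$-graded vector space, $\beta\in gl(V)$ an even linear map and $\eta:\mathcal A\to gl(V)$ an even linear map such that $\eta(\mu(x,y))\beta=\eta(\alpha(x))\eta(y)$. An anti-super-$\mathcal O$-operator on $(\mathcal A,\mu,\alpha)$ associated with $(V,\eta,\beta)$ is an even linear map $T:V\to\mathcal A$ with $T\circ\beta=\alpha\circ T$ and $\mu(T(u),T(v))=-T\big(\eta(T(u))v+(-1)^{|u||v|}\eta(T(v))u\big)$. It is strong if $\eta(\mu(T(u),T(v)))\beta(w)=(-1)^{|u|(|v|+|w|)}\eta(\mu(T(v),T(w)))\beta(u)$ for all homogeneous $u,v,w\in V$. A Hom-anti-Zinbiel superalgebra is a triple $(\mathcal A,\star,\alpha)$ with $\star$ even bilinear and $\alpha$ even linear such that $\alpha(x)\star(y\star z)=-(x\star y+(-1)^{|x||y|}y\star x)\star\alpha(z)$ and $\alpha(x)\star(y\star z)=(-1)^{|x|(|y|+|z|)}\alpha(y)\star(z\star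 x)$. *)

(* Defs.v *)
From HB Require Import structures.
From mathcomp Require Import all_boot all_order all_algebra.

Set Implicit Arguments.
Unset Strict Implicit.
Unset Printing Implicit Defensive.

Import GRing.Theory.
Local Open Scope ring_scope.

(* A Z_2-grading of V is a family g : bool -> {vspace V}, where [g false] is
   the even part and [g true] the odd part, so that parities add by [addb].
   Identities on homogeneous elements quantify over a parity i and an
   x \in g i; in the exponents of signs parities are coerced to nat. *)

Section Superspaces.
Variable K : fieldType.
Implicit Types U V W : vectType K.

Record superspace V (g : bool -> {vspace V}) : Prop := Superspace {
  superspace_direct : (g false :&: g true = 0)%VS;
  superspace_full : (g false + g true = fullv)%VS
}.

Definition even_map V W (gV : bool -> {vspace V}) (gW : bool -> {vspace W})
    (f : V -> W) : Prop :=
  forall i x, x \in gV i -> f x \in gW i.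

Definition even_map2 U V W (gU : bool -> {vspace U}) (gV : bool -> {vspace V})
    (gW : bool -> {vspace W}) (f : U -> V -> W) : Prop :=
  forall i j x y, x \in gU i -> y \in gV j -> f x y \in gW (i (+) j).

Definition hpart V (g : bool -> {vspace V}) (i : bool) : 'End(V) :=
  daddv_pi (g i) (g (~~ i)).

Definition sub_grading V (g : bool -> {vspace V}) (W : {vspace V})
    (i : bool) : {vspace subvs_of W} :=
  (linfun (@vsval K V W) @^-1: g i)%VS.

End Superspaces.

Section HomSuperalgebras.
Variable K : fieldType.
Implicit Types A B V : vectType K.

Record super_comm_hom_assoc A (g : bool -> {vspace A})
    (mu : {bilinear A -> A -> A}) (alpha : 'End(A)) : Prop :=
  SuperCommHomAssoc {
  scha_superspace : superspace g;
  scha_even_mul : even_map2 g g g mu;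
  scha_even_twist : even_map g g alpha;
  scha_comm : forall i j x y, x \in g i -> y \in g j ->
    mu x y = (-1) ^+ (i * j)%N *: mu y x;
  scha_assoc : forall i j k x y z, x \in g i -> y \in g j -> z \in g k ->
    mu (mu x y) (alpha z) = mu (alpha x) (mu y z)
}.

Record super_hom_morphism A (gA : bool -> {vspace A})
    (muA : {bilinear A -> A -> A}) (alphaA : 'End(A))
    B (gB : bool -> {vspace B})
    (muB : {bilinear B -> B -> B}) (alphaB : 'End(B))
    (f : 'Hom(A, B)) : Prop := SuperHomMorphism {
  shm_even : even_map gA gB f;
  shm_mul : forall x y, f (muA x y) = muB (f x) (f y);
  shm_twist : (f \o alphaA = alphaB \o f)%VF
}.

(* [rep_even] says that eta is even for the usual grading of gl(V), whose
   part of degree i consists of the endomorphisms mapping each gV j into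
   gV (i (+) j). *)
Record hom_representation A (gA : bool -> {vspace A})
    (mu : {bilinear A -> A -> A}) (alpha : 'End(A))
    V (gV : bool -> {vspace V}) (eta : 'Hom(A, 'End(V))) (beta : 'End(V))
    : Prop := HomRepresentation {
  rep_superspace : superspace gV;
  rep_even_twist : even_map gV gV beta;
  rep_even : even_map2 gA gV gV (fun x v => eta x v);
  rep_mul : forall i j x y, x \in gA i -> y \in gA j ->
    (eta (mu x y) \o beta = eta (alpha x) \o eta y)%VF
}.

Record anti_super_O_operator A (gA : bool -> {vspace A})
    (mu : {bilinear A -> A -> A}) (alpha : 'End(A))
    V (gV : bool -> {vspace V}) (eta : 'Hom(A, 'End(V))) (beta : 'End(V))
    (T : 'Hom(V, A)) : Prop := AntiSuperOOperator {
  aso_even : even_map gV gA T;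
  aso_twist : (T \o beta = alpha \o T)%VF;
  aso_mul : forall i j u v, u \in gV i -> v \in gV j ->
    mu (T u) (T v) =
      - T (eta (T u) v + (-1) ^+ (i * j)%N *: eta (T v) u)
}.

Definition strong_operator A (mu : {bilinear A -> A -> A})
    V (gV : bool -> {vspace V}) (eta : 'Hom(A, 'End(V))) (beta : 'End(V))
    (T : 'Hom(V, A)) : Prop :=
  forall i j k u v w, u \in gV i -> v \in gV j -> w \in gV k ->
    eta (mu (T u) (T v)) (beta w) =
      (-1) ^+ (i * (j + k))%N *: eta (mu (T v) (T w)) (beta u).

Record hom_anti_zinbiel A (g : bool -> {vspace A})
    (star : {bilinear A -> A -> A}) (alpha : 'End(A)) : Prop :=
  HomAntiZinbiel {
  haz_superspace : superspace g;
  haz_even_mul : even_map2 g g g star;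
  haz_even_twist : even_map g g alpha;
  haz_anti : forall i j k x y z, x \in g i -> y \in g j -> z \in g k ->
    star (alpha x) (star y z) =
      - star (star x y + (-1) ^+ (i * j)%N *: star y x) (alpha z);
  haz_cyclic : forall i j k x y z, x \in g i -> y \in g j -> z \in g k ->
    star (alpha x) (star y z) =
      (-1) ^+ (i * (j + k))%N *: star (alpha y) (star z x)
}.

End HomSuperalgebras.

Section InducedProduct.
Variables (K : fieldType) (A V : vectType K).
Variables (eta : 'Hom(A, 'End(V))) (T : 'Hom(V, A)).

Definition star_op (u v : V) : V := - eta (T u) v.

Lemma star_op_is_bilinear : bilinear_for *:%R *:%R star_op.
Proof.
split=> [v a u u' | u a v v']; rewrite /star_op.
  by rewrite /= !linearP add_lfunE scale_lfunE scalerN opprD.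
by rewrite /= linearP scalerN opprD.
Qed.

HB.instance Definition _ :=
  bilinear_isBilinear.Build K V V V *:%R *:%R star_op star_op_is_bilinear.

End InducedProduct.

Section SuperSymmetrization.
Variables (K : fieldType) (V : vectType K) (g : bool -> {vspace V}).
Variable star : {bilinear V -> V -> V}.

(* The bilinear extension of u, v |-> star u v + (-1)^(|u||v|) star v u to
   arbitrary elements, see [super_symE]. *)
Definition super_sym (u v : V) : V :=
  star u v +
  \sum_(i : bool) \sum_(j : bool)
    (-1) ^+ (i * j)%N *: star (hpart g j v) (hpart g i u).

Lemma super_sym_is_bilinear : bilinear_for *:%R *:%R super_sym.
Proof.
split=> [v a u u' | u a v v']; rewrite /super_sym.
  rewrite /= linearPl scalerDr addrACA scaler_sumr -big_split /=; congr (_ + _).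
  apply: eq_bigr => i _; rewrite scaler_sumr -big_split /=.
  apply: eq_bigr => j _.
  by rewrite linearP linearPr scalerDr !scalerA mulrC.
rewrite /= linearPr scalerDr addrACA scaler_sumr -big_split /=; congr (_ + _).
apply: eq_bigr => i _; rewrite scaler_sumr -big_split /=.
apply: eq_bigr => j _.
by rewrite linearP linearPl scalerDr !scalerA mulrC.
Qed.

HB.instance Definition _ :=
  bilinear_isBilinear.Build K V V V *:%R *:%R super_sym super_sym_is_bilinear.

Lemma hpart_homog i j u : superspace g -> u \in g i ->
  hpart g j u = if j == i then u else 0.
Proof.
case=> cap0 full ui.
have dis k : (g k :&: g (~~ k) = 0)%VS by case: k => //; rewrite capvC.
case: eqP => [-> | /eqP ji]; first by rewrite /hpart daddv_pi_id.
have uj : u \in g (~~ j) by move: ui ji; case: i; case: j.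
have := @daddv_pi_add _ _ _ _ u (dis j) (subvP (addvSr _ _) _ uj).
have disC : (g (~~ j) :&: g j = 0)%VS by rewrite capvC.
by rewrite (daddv_pi_id disC uj) => /(canRL (addrK u)); rewrite subrr.
Qed.

Lemma super_symE i j u v : superspace g -> u \in g i -> v \in g j ->
  super_sym u v = star u v + (-1) ^+ (i * j)%N *: star v u.
Proof.
move=> sg ui vj; rewrite /super_sym; congr (_ + _).
rewrite (bigD1 i) //= (bigD1 j) //= !(hpart_homog _ sg ui) !(hpart_homog _ sg vj).
rewrite !eqxx !big1 ?addr0 // => k ki.
  by rewrite big1 // => l _; rewrite (hpart_homog k sg ui) (negPf ki) linear0r scaler0.
by rewrite (hpart_homog k sg vj) (negPf ki) linear0l scaler0.
Qed.

End SuperSymmetrization.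

(* Main.v *)
(* All the quadratic identities reduce to two computations.  With
   u * v = - eta (T u) v, the operator equation says that
   mu (T u) (T v) = T (u * v + (-1)^(|u||v|) v * u), and then both
   beta u * (v * w) and - (u * v + (-1)^(|u||v|) v * u) * beta w equal
   eta (mu (T u) (T v)) (beta w): the first anti-Zinbiel identity is automatic
   and the second one is strongness.  On the image, T (u * v) depends only on
   T u and T v: if T v = 0 then the homogeneous components of v are killed by T
   as well, and on them the operator equation reads 0 = T (u * v). *)

Require Import Defs.
From HB Require Import structures.
From mathcomp Require Import all_boot all_order all_algebra.

Set Implicit Arguments.
Unset Strict Implicit.
Unset Printing Implicit Defensive.

Import GRing.Theory.
Local Open Scope ring_scope.

(** * Homogeneous components and even maps *)

Section Superspaces.
Variable K : fieldType.

Section Parts.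
Variables (V : vectType K) (g : bool -> {vspace V}).

Lemma mem_hpart i u : hpart g i u \in g i.
Proof. exact: memv_pi. Qed.

Hypothesis sg : superspace g.

Lemma hpart_sum u : \sum_(i : bool) hpart g i u = u.
Proof.
have: u \in (g false + g true)%VS by rewrite (superspace_full sg) memvf.
case/memv_addP=> u0 u0P [u1 u1P ->]; rewrite big_bool !linearD /=.
rewrite !(hpart_homog _ sg u0P) !(hpart_homog _ sg u1P) /=.
by rewrite add0r addr0 addrC.
Qed.

(** Every vector is the sum of its two homogeneous components. This induction extends additive
    identities from homogeneous elements to all vectors. *)
Lemma homog_ind (P : V -> Prop) :
    (forall u v, P u -> P v -> P (u + v)) ->
    (forall i u, u \in g i -> P u) ->
  forall u, P u.
Proof.
move=> PD Pg u; rewrite -(hpart_sum u) big_bool.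
by apply: PD; apply: Pg; apply: mem_hpart.
Qed.

End Parts.

Lemma even_map_hpart (V W : vectType K) (gV : bool -> {vspace V})
    (gW : bool -> {vspace W}) (f : 'Hom(V, W)) i u :
  superspace gV -> superspace gW -> even_map gV gW f ->
  f (hpart gV i u) = hpart gW i (f u).
Proof.
move=> sV sW fE; elim/(homog_ind sV): u => [u v IHu IHv|j u ui].
  by rewrite !linearD /= IHu IHv.
rewrite (hpart_homog _ sV ui) (hpart_homog _ sW (fE _ _ ui)).
by case: ifP => // _; rewrite linear0.
Qed.

(** Even maps commute with [hpart], so the component of degree [i] of any preimage of [x] is still a
    preimage. *)
Lemma even_map_lift (V W : vectType K) (gV : bool -> {vspace V})
    (gW : bool -> {vspace W}) (f : 'Hom(V, W)) i x :
  superspace gV -> superspace gW -> even_map gV gW f ->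
  x \in limg f -> x \in gW i -> exists2 u, u \in gV i & x = f u.
Proof.
move=> sV sW fE /memv_imgP[u _ ->] xi.
exists (hpart gV i u); first exact: mem_hpart.
by rewrite (even_map_hpart _ _ sV sW fE) (hpart_homog _ sW xi) eqxx.
Qed.

Lemma mem_sub_grading (W : vectType K) (g : bool -> {vspace W})
    (U : {vspace W}) i (x : subvs_of U) :
  (x \in sub_grading g U i) = (vsval x \in g i).
Proof. by rewrite /sub_grading -memv_preim lfunE. Qed.

(** The components of [f u] are the images of the components of [u], hence they stay inside
    [limg f]. *)
Lemma sub_grading_superspace (V W : vectType K) (gV : bool -> {vspace V})
    (gW : bool -> {vspace W}) (f : 'Hom(V, W)) :
  superspace gV -> superspace gW -> even_map gV gW f ->
  superspace (sub_grading gW (limg f)).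
Proof.
move=> sV sW fE; split.
  apply/eqP; rewrite -subv0; apply/subvP => x; rewrite memv_cap.
  rewrite !mem_sub_grading -memv_cap (superspace_direct sW) !memv0 => /eqP x0.
  by apply/eqP/val_inj.
apply/eqP; rewrite eqEsubv subvf; apply/subvP => x _.
have [u _ xE] := memv_imgP (subvsP x).
have fuP v : f v \in limg f by rewrite memv_img ?memvf.
have -> : x = vsproj (limg f) (f (hpart gV false u))
            + vsproj (limg f) (f (hpart gV true u)).
  apply: val_inj; rewrite linearD /= !vsprojK // -linearD addrC.
  by rewrite [vsval x]xE -[in LHS](hpart_sum sV u) big_bool.
by apply: memv_add; rewrite mem_sub_grading vsprojK //; apply/fE/mem_hpart.
Qed.

End Superspaces.

(** * Super-symmetrization of a Hom-anti-Zinbiel product *)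

Lemma haz_super_comm_hom_assoc (K : fieldType) (V : vectType K)
    (g : bool -> {vspace V}) (star : {bilinear V -> V -> V}) (beta : 'End(V)) :
  hom_anti_zinbiel g star beta ->
  super_comm_hom_assoc g (super_sym g star) beta.
Proof.
case=> sg starE betaE anti cyc.
have symE i j u v (ui : u \in g i) (vj : v \in g j) :=
  super_symE star sg ui vj.
have sym_even : even_map2 g g g (super_sym g star).
  move=> i j u v ui vj /=; rewrite (symE i j) //.
  apply: rpredD; first exact: starE.
  by rewrite addbC; apply/rpredZ/starE.
split=> //.
  move=> i j u v ui vj /=; rewrite (symE i j) // (symE j i) //.
  by rewrite scalerDr scalerA mulnC -expr2 sqrr_sign scale1r addrC.
move=> i j k u v w ui vj wk /=.
rewrite (symE _ _ _ _ (sym_even _ _ _ _ ui vj) (betaE _ _ wk)).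
rewrite (symE _ _ _ _ (betaE _ _ ui) (sym_even _ _ _ _ vj wk)).
rewrite (symE _ _ _ _ ui vj) (symE _ _ _ _ vj wk).
(* The first anti-Zinbiel identity, read backwards, turns every left-bracketed term into one of the
   form [star (beta x) (star y z)]. *)
rewrite -[X in X + _]opprK -(anti i j k) //.
have -> : star (star v w + (-1) ^+ (j * k)%N *: star w v) (beta u) =
    - star (beta v) (star w u) by rewrite (anti j k i) // opprK.
rewrite !linearDr !linearZr /=.
(* Cyclic moves bring all terms to signed copies of [star (beta v) (star w u)] or
   [star (beta v) (star u w)]. It remains to compare exponents mod 2, over the eight parity
   triples. *)
rewrite (cyc k i j _ _ _ wk ui vj) (cyc i j k _ _ _ ui vj wk).
rewrite (cyc i k j _ _ _ ui wk vj) (cyc k j i _ _ _ wk vj ui).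
rewrite [RHS]addrAC scalerN scalerDr !scalerA -!exprD addrA.
have sign_odd m n : odd m = odd n -> (-1) ^+ m = (-1) ^+ n :> K.
  by move=> mn; rewrite -signr_odd mn signr_odd.
congr (_ + _); last first.
  by congr (_ *: _); apply: sign_odd; case: (i) (j) (k) => [] [] [].
rewrite addrC; congr (_ *: _ - _ *: _); apply: sign_odd.
  by case: (i) (j) (k) => [] [] [].
by case: (i) (j) (k) => [] [] [].
Qed.

(** * Products on the image of a linear map *)

Section Image.
Variables (K : fieldType) (A V : vectType K) (T : 'Hom(V, A)).

(** The inverse [T^-1] is a linear section of [T] over its image, which makes bilinearity immediate.
    Independence of the chosen preimages is a separate matter, settled by [image_opE]. *)
Definition image_op (star : {bilinear V -> V -> V})
    (x y : subvs_of (limg T)) : subvs_of (limg T) :=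
  vsproj (limg T) (T (star ((T^-1)%VF (vsval x)) ((T^-1)%VF (vsval y)))).

Lemma image_op_is_bilinear star : bilinear_for *:%R *:%R (image_op star).
Proof.
split=> [y a x x' | x a y y']; rewrite /image_op /=.
  by rewrite !linearP /= linearPl !linearP.
by rewrite !linearP.
Qed.

HB.instance Definition _ star :=
  bilinear_isBilinear.Build K _ _ _ *:%R *:%R (image_op star)
    (image_op_is_bilinear star).

End Image.

(* A surjective even map transports the anti-Zinbiel identities, because
   homogeneous elements lift to homogeneous elements of the same parity. *)
Lemma haz_image (K : fieldType) (V W : vectType K)
    (gV : bool -> {vspace V}) (gW : bool -> {vspace W})
    (starV : {bilinear V -> V -> V}) (starW : {bilinear W -> W -> W})
    (beta : 'End(V)) (alpha : 'End(W)) (f : 'Hom(V, W)) :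
  hom_anti_zinbiel gV starV beta -> superspace gW ->
  even_map gV gW f -> limg f = fullv ->
  (forall u v, starW (f u) (f v) = f (starV u v)) ->
  (forall u, alpha (f u) = f (beta u)) ->
  hom_anti_zinbiel gW starW alpha.
Proof.
case=> sV starE betaE anti cyc sW fE f_surj starP alphaP.
have lift i x : x \in gW i -> exists2 u, u \in gV i & x = f u.
  by apply: even_map_lift => //; rewrite f_surj memvf.
split=> //.
- move=> i j _ _ /lift[u ui ->] /lift[v vj ->].
  by rewrite starP; apply: fE; apply: starE.
- by move=> i _ /lift[u ui ->]; rewrite alphaP; apply/fE/betaE.
- move=> i j k _ _ _ /lift[u ui ->] /lift[v vj ->] /lift[w wk ->].
  rewrite !starP !alphaP starP (anti i j k) // linearN /= -(starP (_ + _)).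
  by rewrite linearD linearZ.
move=> i j k _ _ _ /lift[u ui ->] /lift[v vj ->] /lift[w wk ->].
by rewrite !starP !alphaP !starP (cyc i j k) // linearZ.
Qed.

(** * Strong operators, the morphism property and the structure on the image *)

Section OOperator.
Variables (K : fieldType) (A V : vectType K).
Variables (gA : bool -> {vspace A}) (gV : bool -> {vspace V}).
Variables (mu : {bilinear A -> A -> A}) (alpha : 'End(A)).
Variables (eta : 'Hom(A, 'End(V))) (beta : 'End(V)) (T : 'Hom(V, A)).
Hypothesis hA : super_comm_hom_assoc gA mu alpha.
Hypothesis hV : hom_representation gA mu alpha gV eta beta.
Hypothesis hT : anti_super_O_operator gA mu alpha gV eta beta T.

Let sA := scha_superspace hA.
Let sV := rep_superspace hV.
Let T_even := aso_even hT.

Local Notation star := (star_op eta T).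

Lemma mul_O_operator i j u v : u \in gV i -> v \in gV j ->
  mu (T u) (T v) = T (star u v + (-1) ^+ (i * j)%N *: star v u).
Proof.
move=> ui vj; rewrite (aso_mul hT ui vj) -linearN opprD.
by rewrite /star_op scalerN.
Qed.

Lemma O_operator_twist u : T (beta u) = alpha (T u).
Proof. by have /lfunP/(_ u) := aso_twist hT; rewrite !comp_lfunE. Qed.

(** The two minus signs cancel; [T] intertwines the twists, and [rep_mul] then merges the two
    actions. *)
Lemma star_op_assoc i j k u v w :
    u \in gV i -> v \in gV j -> w \in gV k ->
  star (beta u) (star v w) = eta (mu (T u) (T v)) (beta w).
Proof.
move=> ui vj wk; rewrite /star_op linearN opprK O_operator_twist.
have /lfunP/(_ w) := rep_mul hV (T_even ui) (T_even vj).
by rewrite !comp_lfunE.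
Qed.

Lemma haz_star_op_strong :
  hom_anti_zinbiel gV star beta <-> strong_operator mu gV eta beta T.
Proof.
split=> [haz i j k u v w ui vj wk | strong].
  rewrite -(star_op_assoc ui vj wk) -(star_op_assoc vj wk ui).
  exact: haz_cyclic haz _ _ _ _ _ _ ui vj wk.
split=> //.
- move=> i j u v ui vj; rewrite /= /star_op rpredN.
  by apply: (rep_even hV) => //; apply: T_even.
- exact: rep_even_twist hV.
- move=> i j k u v w ui vj wk /=.
  rewrite (star_op_assoc ui vj wk) (mul_O_operator ui vj).
  by rewrite /star_op opprK.
move=> i j k u v w ui vj wk /=.
by rewrite (star_op_assoc ui vj wk) (star_op_assoc vj wk ui); apply: strong.
Qed.

Lemma O_operator_mul u v : T (super_sym gV star u v) = mu (T u) (T v).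
Proof.
elim/(homog_ind sV): u => [u u' IHu IHu' | i u ui].
  by rewrite linearDl linearD /= IHu IHu' linearD linearDl.
elim/(homog_ind sV): v => [v v' IHv IHv' | j v vj].
  by rewrite linearDr linearD /= IHv IHv' linearD linearDr.
by rewrite (super_symE _ sV ui vj) (mul_O_operator ui vj).
Qed.

Lemma O_operator_morphism :
  super_hom_morphism gV (super_sym gV star) beta gA mu alpha T.
Proof.
by split; [exact: T_even | exact: O_operator_mul | exact: aso_twist hT].
Qed.

Lemma star_op_ker u v : T v = 0 -> T (star u v) = 0.
Proof.
move=> Tv0; have Tv_hpart i : T (hpart gV i v) = 0.
  by rewrite (even_map_hpart _ _ sV sA T_even) Tv0 linear0.
rewrite -[v](hpart_sum sV) linear_sumr linear_sum big1 // => j _.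
have vj := mem_hpart gV j v; move: (hpart _ _ _) vj (Tv_hpart j) => w wj Tw0.
elim/(homog_ind sV): u => [u u' IHu IHu' | i u ui].
  by rewrite linearDl linearD /= IHu IHu' addr0.
(* Since [T w = 0], both [mu (T u) (T w)] and [star w u] vanish, leaving only [T (star u w)]. *)
have := mul_O_operator ui wj.
by rewrite Tw0 linear0r /star_op Tw0 linear0 zero_lfunE oppr0 scaler0 addr0.
Qed.

Lemma image_opE u v :
  vsval (image_op star (vsproj (limg T) (T u)) (vsproj (limg T) (T v))) =
  T (star u v).
Proof.
have TP w : T w \in limg T by rewrite memv_img ?memvf.
rewrite /image_op /= !vsprojK //; set u' := (T^-1)%VF _; set v' := (T^-1)%VF _.
have Tu' : T u' = T u by rewrite limg_lfunVK.
(* The first argument enters [star] only through [T]; for the second, [v' - v] lies in the kernel of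
   [T] and [star_op_ker] applies. *)
have -> : star u' v' = star u v' by rewrite /star_op Tu'.
apply/eqP; rewrite -subr_eq0 -linearB -linearBr; apply/eqP/star_op_ker.
by rewrite linearB /= limg_lfunVK // subrr.
Qed.

(** This is the restriction of [alpha]: it preserves the image because [alpha (T u) = T (beta u)],
    so the projection changes nothing. *)
Definition image_twist : 'End(subvs_of (limg T)) :=
  (linfun (vsproj (limg T)) \o alpha \o linfun vsval)%VF.

Lemma image_twistE x : vsval (image_twist x) = alpha (vsval x).
Proof.
rewrite !comp_lfunE !lfunE /= vsprojK //.
have /memv_imgP[u _ ->] := subvsP x.
by rewrite -O_operator_twist memv_img ?memvf.
Qed.

Lemma haz_image_op :
  strong_operator mu gV eta beta T ->
  hom_anti_zinbiel (sub_grading gA (limg T)) (image_op star) image_twist.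
Proof.
move=> /haz_star_op_strong haz.
have TP w : T w \in limg T by rewrite memv_img ?memvf.
(* Restricting the codomain of [T] to its image gives a surjective even map, along which [haz_image]
   transports the structure. *)
pose f : 'Hom(V, subvs_of (limg T)) := (linfun (vsproj (limg T)) \o T)%VF.
have fE u : f u = vsproj (limg T) (T u) by rewrite comp_lfunE lfunE.
apply: (haz_image (f := f) haz).
- exact: sub_grading_superspace sV sA T_even.
- by move=> i u ui; rewrite mem_sub_grading fE vsprojK // T_even.
- apply/eqP; rewrite eqEsubv subvf; apply/subvP => x _.
  have [u _ xE] := memv_imgP (subvsP x).
  have -> : x = f u by apply: val_inj; rewrite fE /= vsprojK.
  by rewrite memv_img ?memvf.
- by move=> u v; apply: val_inj; rewrite !fE /= image_opE vsprojK.
- move=> u; apply: val_inj; rewrite /= image_twistE !fE !vsprojK //.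
  by rewrite O_operator_twist.
Qed.

End OOperator.

Theorem theorem3p1 (K : fieldType) (charK0 : [pchar K] =i pred0)
    (A V : vectType K)
    (gA : bool -> {vspace A}) (gV : bool -> {vspace V})
    (mu : {bilinear A -> A -> A}) (alpha : 'End(A))
    (eta : 'Hom(A, 'End(V))) (beta : 'End(V)) (T : 'Hom(V, A))
    (hA : super_comm_hom_assoc gA mu alpha)
    (hV : hom_representation gA mu alpha gV eta beta)
    (hT : anti_super_O_operator gA mu alpha gV eta beta T) :
  (hom_anti_zinbiel gV (star_op eta T) beta <->
     strong_operator mu gV eta beta T) /\
  (strong_operator mu gV eta beta T ->
     [/\ super_comm_hom_assoc gV (super_sym gV (star_op eta T)) beta,
         super_hom_morphism gV (super_sym gV (star_op eta T)) beta
           gA mu alpha T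
       & exists (star : {bilinear subvs_of (limg T) -> subvs_of (limg T)
                                  -> subvs_of (limg T)})
                (alphaT : 'End(subvs_of (limg T))),
           [/\ forall x, vsval (alphaT x) = alpha (vsval x),
               forall i j u v, u \in gV i -> v \in gV j ->
                 vsval (star (vsproj (limg T) (T u)) (vsproj (limg T) (T v)))
                   = T (star_op eta T u v)
             & hom_anti_zinbiel (sub_grading gA (limg T)) star alphaT]]).
Proof.
split; first exact: haz_star_op_strong hV hT.
move=> strong; have haz := (haz_star_op_strong hV hT).2 strong.
split; first exact: haz_super_comm_hom_assoc.
  exact: O_operator_morphism hV hT.
exists (image_op (T := T) (star_op eta T)), (image_twist alpha T); split.
- exact: image_twistE hT.
- by move=> i j u v _ _; apply: image_opE hA hV hT _ _.
- exact: haz_image_op hA hV hT strong.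
Qed.
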